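(* Let $S_n$ be the symmetric group on $n$ letters. (i) For $n\ge 2$, the first player has a winning strategy for $\mathsf{DNG}(S_n)$ if and only if $n\in\{2,3\}$. (ii) For $n\ge 1$, the first player has a winning strategy for $\mathsf{GEN}(S_n)$ if and only if $n\notin\{1,4\}$.
   Context: Let $G$ be a finite group. In both games two players alternately select previously-unselected elements of $G$, starting from the empty set; a position is the set $P\subseteq G$ of jointly selected elements. Achievement game $\mathsf{GEN}(G)$: a position $P$ with $\langle P\rangle=G$ is terminal and the player who moved into it wins; otherwise the options of $P$ are the sets $P\cup\{g\}$ with $g\in G\setminus P$. If $G$ is trivial, $\emptyset$ is already terminal, so the first player has no legal move and the second player is considered to win. Avoidance game $\mathsf{DNG}(G)$ (for $G$ nontrivial): positions are the subsets $P$ with $\langle P\rangle\ne G$, and the options of $P$ are the sets $P\cup\{g\}$ with $g\in G\setminus P$ and $\langle P\cup\{g\}\rangle\ne G$. A player who cannot move loses. There is no avoidance game for the trivial group. *)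

(* Defs.v *)
From mathcomp Require Import all_boot all_fingroup.

Set Implicit Arguments.
Unset Strict Implicit.
Unset Printing Implicit Defensive.

Local Open Scope group_scope.

Section Games.
Variables (T : finType) (opt : rel T) (start : T).

Definition terminal (P : T) : bool := [forall Q, ~~ opt P Q].

(* A play is recorded as the sequence of positions reached after each move,
   the starting position being omitted: [path opt start ps] says that [ps] is
   legal, and the first player makes the moves with even index. A strategy of
   the first player may depend on the whole history of the play. *)
Definition follows (s : seq T -> T) (ps : seq T) : Prop :=
  forall i, i < size ps -> ~~ odd i -> nth start ps i = s (take i ps).

(* The player who makes the last move wins, so the first player wins a finished
   play iff its length is odd; a winning strategy must moreover prescribe a
   legal move whenever the play is unfinished and the first player is to move.
   This is meaningful for games without infinite plays, such as those below,
   where positions strictly increase. *)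
Definition winning_strategy (s : seq T -> T) : Prop :=
  forall ps, path opt start ps -> follows s ps ->
    if terminal (last start ps) then odd (size ps)
    else ~~ odd (size ps) ==> opt (last start ps) (s ps).

Definition first_player_wins : Prop :=
  exists s : seq T -> T, winning_strategy s.

End Games.

Section GroupGames.
Variables (gT : finGroupType) (G : {group gT}).

Definition gen_option (P Q : {set gT}) : bool :=
  (<<P>> != G) && [exists g in G :\: P, Q == g |: P].

Definition dng_option (P Q : {set gT}) : bool :=
  [&& <<P>> != G, <<Q>> != G & [exists g in G :\: P, Q == g |: P]].

Definition first_player_wins_GEN : Prop := first_player_wins gen_option set0.

(* Only meaningful for nontrivial [G]: otherwise [set0] is not a position. *)
Definition first_player_wins_DNG : Prop := first_player_wins dng_option set0.

End GroupGames.

(* Main.v *)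
Require Import Defs.
From mathcomp Require Import all_boot all_fingroup all_solvable.

(** Both games only ever enlarge the position, so a player is sure to win as
    soon as there is a set of positions, closed under replies, in which the
    opponent always has to move: [reply_closed], [first_player_winsI] and
    [first_player_losesI].

    Avoidance. A finished play fills a maximal subgroup, so only the parity of
    its order matters. If n >= 4, the second player can force that order to be
    even: an odd permutation has even order, and to an even permutation the
    second player replies with a double transposition, which leaves the
    position inside the proper subgroup A_n ([first_player_loses_DNG]). If
    n = 2 or 3, then A_n is cyclic of odd order and maximal, and the first
    player starts with a generator of it ([first_player_wins_DNG_index2]).

    Achievement. If n >= 3 and n <> 4, then every nontrivial x in S_n belongs
    to a generating pair, a theorem of Isaacs and Zieschang ([mate_odd] and
    [mate_even]). The first player therefore plays 1 and, whatever x comes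
    next, completes a generating set at once. In S_4 the permutations that
    belong to no generating pair are exactly those of the Klein group V. Nobody
    may leave V first: the position would not yet generate, because S_4 / V is
    not cyclic, and the opponent would then win at once. So both players fill
    V, whose order is even, and the first player runs out of elements of V
    first ([first_player_loses_GEN_normal]).

    Generating pairs. For a subgroup G, the relation tperm u v \in G between
    points is a G-invariant equivalence, and G is everything once a single class
    contains all points. As a mate of x, take for y the product of a
    transposition (a b) and a disjoint cycle of odd length k. Then y ^ k is
    (a b), so a and b are equivalent, and a class that contains a point of the
    cycle and either a point outside it or two consecutive points of it
    contains the whole cycle ([paired_cycle_mate]). It remains to place a, b
    and the cycle so that x merges the classes. If the number of points is odd,
    the cycle can run through all points other than a and b; if it is even, one
    point f has to remain fixed by y, and the placement depends on whether x
    has a cycle of length at least 3 ([mate_long_cycle]), moves at least two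
    pairs of points ([mate_two_swaps]), or is itself a transposition, when an
    n-cycle is a better mate ([mate_tperm]). *)

Set Implicit Arguments.
Unset Strict Implicit.
Unset Printing Implicit Defensive.

(** * Winning by replies *)

Section Replies.

Variables (T : finType) (opt : rel T).

Definition reply_closed (B : pred T) : Prop :=
  forall P Q, B P -> opt P Q -> exists2 R, opt Q R & B R.

(** The strategy is to make any legal move into [B]. Such a move exists at the
    start and, by closure, after every reply, so a play can only stop after a
    move of the first player. *)
Lemma first_player_winsI (B : pred T) start Q :
  reply_closed B -> opt start Q -> B Q -> first_player_wins opt start.
Proof.
move=> Bcl optQ BQ.
pose s ps := odflt start [pick R | opt (last start ps) R && B R].
exists s => ps pth fol.
have sP P : last start ps = P -> (exists2 R, opt P R & B R) ->
    opt (last start ps) (s ps) && B (s ps).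
  move=> lastP [R optR BR]; rewrite /s.
  by case: pickP => [//|/(_ R)]; rewrite lastP optR BR.
have inv : if odd (size ps) then is_true (B (last start ps))
    else exists2 R, opt (last start ps) R & B R.
  elim/last_ind: ps pth fol {sP} => [_ _|ps P IHps]; first by exists Q.
  rewrite rcons_path last_rcons size_rcons => /andP[pth optP] fol.
  have fol' : follows start s ps.
    move=> i ltips evi; have:= fol i; rewrite size_rcons nth_rcons ltips.
    by rewrite (leqW ltips) -cats1 takel_cat ?(ltnW ltips) // => /(_ isT evi).
  have /= := IHps pth fol'.
  case: ifP => [odd_ps Blast | even_ps [R optR BR]] /=.
    exact: Bcl Blast optP.
  (* The even-indexed moves are those of the strategy, hence lead into [B]. *)
  have := fol (size ps); rewrite size_rcons ltnSn even_ps nth_rcons ltnn eqxx.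
  rewrite -cats1 take_size_cat // => /(_ isT isT) ->; rewrite /s.
  by case: pickP => [R' /andP[]|/(_ R)] //; rewrite optR BR.
case: ifP => [/forallP term|nterm]; last first.
  apply/implyP=> /negPf even_ps; rewrite even_ps in inv.
  by have /andP[] := sP _ erefl inv.
by case: ifP inv => // _ [R]; rewrite (negPf (term R)).
Qed.

(** Replying in [B] against a supposed winning strategy produces plays of
    arbitrary length in which that strategy is followed, whereas the measure
    [m] bounds the length of every play. *)
Lemma first_player_losesI (B : pred T) (m : T -> nat) N start :
    (forall P Q, opt P Q -> m P < m Q <= N) ->
  reply_closed B -> B start -> ~ first_player_wins opt start.
Proof.
move=> m_opt Bcl Bstart [s s_win].
suffices no_play k : forall ps, N - m (last start ps) < k -> path opt start ps ->
    follows start s ps -> ~~ odd (size ps) -> B (last start ps) -> False.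
  by apply: (no_play _ [::] (ltnSn _)) => // i.
elim: k => // k IHk ps ltk pth fol even_ps Blast.
have := s_win ps pth fol; case: ifP => [_|_]; first by apply/negP.
rewrite even_ps /= => optQ; set Q := s ps in optQ.
have [R optR BR] := Bcl _ _ Blast optQ.
apply: (IHk (rcons (rcons ps Q) R)); rewrite ?last_rcons ?size_rcons /= ?negbK //.
- have /andP[mQ _] := m_opt _ _ optQ; have /andP[mR mRN] := m_opt _ _ optR.
  rewrite ltnS in ltk; apply: leq_trans ltk; apply: ltn_sub2l.
    exact: leq_trans (ltn_trans mQ mR) mRN.
  exact: ltn_trans mQ mR.
- by rewrite !rcons_path pth optQ last_rcons.
move=> i; rewrite !size_rcons !ltnS leq_eqVlt => /predU1P[->|].
  by rewrite /= even_ps.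
rewrite ltnS leq_eqVlt => /predU1P[-> _|ltips evi].
  rewrite nth_rcons size_rcons ltnSn nth_rcons ltnn eqxx.
  by rewrite -!cats1 -catA take_size_cat.
rewrite nth_rcons size_rcons (leqW ltips) nth_rcons ltips fol //.
by rewrite -!cats1 -catA takel_cat // ltnW.
Qed.

End Replies.

(** * Achievement and avoidance games of an arbitrary finite group *)

Section GroupGames.

Local Open Scope group_scope.

Variables (gT : finGroupType) (G : {group gT}).
Implicit Types P Q : {set gT}.

Lemma gen_optionP P Q :
  reflect (<<P>> <> G /\ exists2 g, g \in G :\: P & Q = g |: P) (gen_option G P Q).
Proof.
apply: (iffP andP) => [[/eqP nG /exists_inP[g Gg /eqP ->]]|[/eqP nG [g Gg ->]]].
  by split=> //; exists g.
by split=> //; apply/exists_inP; exists g.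
Qed.

Lemma dng_optionP P Q :
  reflect [/\ <<P>> <> G, <<Q>> <> G & exists2 g, g \in G :\: P & Q = g |: P]
          (dng_option G P Q).
Proof.
apply: (iffP and3P) => [[/eqP nG /eqP nG' /exists_inP[g Gg /eqP defQ]]|].
  by split=> //; exists g.
case=> /eqP nG /eqP nG' [g Gg defQ].
by split=> //; apply/exists_inP; exists g; rewrite ?defQ.
Qed.

Lemma gen_option_card P Q : gen_option G P Q -> #|P| < #|Q| <= #|gT|.
Proof.
by case/gen_optionP=> _ [g /setDP[_ P'g] ->]; rewrite max_card cardsU1 P'g ltnSn.
Qed.

Lemma dng_option_gen P Q : dng_option G P Q -> gen_option G P Q.
Proof. by case/dng_optionP=> nG _ Q_P; apply/gen_optionP. Qed.

Lemma first_player_wins_GEN_cyclic :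
  cyclic G -> G :!=: 1 -> first_player_wins_GEN G.
Proof.
case/cyclicP=> g defG ntG.
apply: (@first_player_winsI _ _ (fun P => <<P>> == G) _ [set g]).
- by move=> P Q /eqP nG /gen_optionP[].
- apply/gen_optionP; rewrite gen0; split; first by move=> e; rewrite -e eqxx in ntG.
  by exists g; rewrite ?setU0 // setD0 defG cycle_id.
by rewrite defG.
Qed.

Lemma gen_of_generating_pair P x y :
  P \subset G -> x \in P -> y \in P -> <<[set x; y]>> = G -> <<P>> = G.
Proof.
move=> sPG Px Py defG; apply/eqP; rewrite eqEsubset gen_subG sPG -{1}defG.
by rewrite genS // subUset !sub1set Px.
Qed.

(** The first player plays 1. As [G] is not cyclic, the reply [x] does not
    complete a generating set, but the next move does. *)
Lemma first_player_wins_GEN_mates :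
    ~~ cyclic G ->
    (forall x, x \in G -> x != 1 -> exists2 y, y \in G & <<[set x; y]>> = G) ->
  first_player_wins_GEN G.
Proof.
move=> ncG mates.
have nG_cyc x : <[x]> <> G by move=> e; rewrite -e cycle_cyclic in ncG.
have nG1 : <<[set 1 : gT]>> <> G by move=> e; apply: (nG_cyc 1).
apply: (@first_player_winsI _ _ (fun P => (P == [set 1]) || (<<P>> == G)) _ [set 1]).
- move=> P Q /orP[/eqP->|/eqP eG /gen_optionP[]//] /gen_optionP[_ [x]].
  rewrite 2!inE => /andP[x1 Gx] ->.
  have [y Gy defG] := mates x Gx x1.
  have ngx : <<x |: [set 1]>> <> G.
    move=> e; apply: (nG_cyc x); rewrite -e; apply/eqP.
    rewrite eqEsubset cycle_subG mem_gen ?setU11 // gen_subG subUset !sub1set.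
    by rewrite cycle_id group1.
  have sxG : x |: [set 1] \subset G by rewrite subUset !sub1set Gx group1.
  exists (y |: (x |: [set 1])).
    apply/gen_optionP; split=> //; exists y => //.
    rewrite inE Gy andbT; apply/negP=> xy; apply: ngx.
    by apply: gen_of_generating_pair defG; rewrite // setU11.
  apply/orP; right; apply/eqP; apply: gen_of_generating_pair defG.
  - by rewrite subUset sub1set Gy.
  - by rewrite !inE eqxx orbT.
  - by rewrite setU11.
- apply/gen_optionP; rewrite gen0; split; first by rewrite -cycle1.
  by exists 1; rewrite ?setU0 // setD0.
by rewrite eqxx.
Qed.

Lemma first_player_loses_GEN_trivial : G :=: 1 -> ~ first_player_wins_GEN G.
Proof.
move=> G1; apply: (first_player_losesI (B := fun P => <<P>> == G) gen_option_card).
  by move=> P Q /eqP nG /gen_optionP[].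
by rewrite gen0 G1.
Qed.

Lemma parity_proper (H : {group gT}) P :
  odd #|P| != odd #|H| -> P \subset H -> exists2 g, g \in H & g \notin P.
Proof.
move=> parPH sPH; have /properP[_ [g Hg P'g]] : P \proper H; last by exists g.
rewrite properE sPH; apply: contra parPH => sHP.
by have -> : P = H by apply/eqP; rewrite eqEsubset sPH.
Qed.

(** A subset of [V] together with one more element does not generate [G], since
    it would make [G / V] cyclic. So the first move outside [V] does not win,
    but it allows the opponent to win with a mate of the element just played.
    As long as nobody leaves [V], the second player is the one who completes
    pairs inside a set of even cardinal. *)
Lemma first_player_loses_GEN_normal (V : {group gT}) :
    V <| G -> 2 %| #|V| -> ~~ cyclic (G / V) ->
    (forall x, x \in G :\: V -> exists2 y, y \in G & <<[set x; y]>> = G) ->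
  ~ first_player_wins_GEN G.
Proof.
move=> nVG evV ncGV mates.
have nG (P : {set gT}) g : P \subset V -> g \in G -> <<g |: P>> <> G.
  move=> sPV Gg eG; case/negP: ncGV; have nVG' := normal_norm nVG.
  have sgG : <[g]> \subset G by rewrite cycle_subG.
  have -> : G :=: V <*> <[g]>.
    apply/eqP; rewrite eqEsubset join_subG (normal_sub nVG) sgG andbT -{1}eG.
    rewrite gen_subG subUset sub1set (subset_trans sPV) ?joing_subl // andbT.
    by rewrite (subsetP (joing_subr _ _)) ?cycle_id.
  by rewrite quotientYidl ?quotient_cyclic ?cycle_cyclic // (subset_trans sgG).
pose B P := (<<P>> == G) || (P \subset V) && ~~ odd #|P|.
apply: (first_player_losesI (B := B) gen_option_card); last first.
  by rewrite /B sub0set cards0 orbT.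
move=> P Q /orP[/eqP eG /gen_optionP[]//|/andP[sPV evP]].
move=> /gen_optionP[_ [g /setDP[Gg P'g] ->]].
have nGQ := nG P g sPV Gg.
have [Vg|V'g] := boolP (g \in V).
  have oddQ : odd #|g |: P| by rewrite cardsU1 P'g.
  have sQV : g |: P \subset V by rewrite subUset sub1set Vg.
  have [|h Vh Q'h] := parity_proper _ sQV.
    by rewrite oddQ -[odd _]negbK -dvdn2 evV.
  exists (h |: (g |: P)).
    apply/gen_optionP; split=> //; exists h => //.
    by rewrite inE Q'h (subsetP (normal_sub nVG)).
  by rewrite /B subUset sub1set Vh sQV cardsU1 Q'h /= oddQ orbT.
have [|h Gh defG] := mates g; first by rewrite inE V'g.
have gen_h : <<h |: (g |: P)>> = G.
  apply: gen_of_generating_pair defG.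
  - by rewrite !subUset !sub1set Gh Gg (subset_trans sPV) ?normal_sub.
  - by rewrite !inE eqxx orbT.
  - by rewrite setU11.
exists (h |: (g |: P)); last by rewrite /B gen_h eqxx.
apply/gen_optionP; split=> //; exists h => //; rewrite inE Gh andbT.
apply/negP=> Qh; apply: nGQ; have hQ : h |: (g |: P) = g |: P.
  by apply/setUidPr; rewrite sub1set.
by rewrite -gen_h hQ.
Qed.

(** A subgroup of index 2 is maximal: once a generator of [M] has been selected,
    only elements of [M] can follow, and there is an odd number of them. *)
Lemma first_player_wins_DNG_index2 (M : {group gT}) :
    M \subset G -> #|G : M| = 2 -> cyclic M -> odd #|M| ->
  first_player_wins_DNG G.
Proof.
move=> sMG indM cycM oddM.
have /maxgroupP[/andP[_ prM] maxM] : maximal M G.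
  by apply: p_index_maximal; rewrite ?indM.
case/cyclicP: cycM => m defM.
have Mm : m \in M by rewrite defM cycle_id.
have ngM P : P \subset M -> <<P>> <> G.
  by move=> sPM eG; case/negP: prM; rewrite -eG gen_subG.
apply: (@first_player_winsI _ _ (fun P => [&& m \in P, P \subset M & odd #|P|]) _ [set m]).
- move=> P Q /and3P[Pm sPM oddP] /dng_optionP[_ nQG [g /setDP[Gg P'g] defQ]].
  have Mg : g \in M.
    have sMQ : M \subset <<Q>>.
      by rewrite {1}defM cycle_subG mem_gen // defQ inE Pm orbT.
    rewrite -(maxM <<Q>>%G _ sMQ) ?mem_gen ?defQ ?setU11 //=.
    rewrite -defQ properE gen_subG {1}defQ subUset sub1set Gg (subset_trans sPM) //=.
    apply/negP=> sGQ; case: nQG; apply/eqP; rewrite eqEsubset sGQ andbT.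
    by rewrite gen_subG defQ subUset sub1set Gg (subset_trans sPM).
  have sQM : Q \subset M by rewrite defQ subUset sub1set Mg.
  have evQ : ~~ odd #|Q| by rewrite defQ cardsU1 P'g /= oddP.
  have [|h Mh Q'h] := parity_proper _ sQM; first by rewrite oddM (negPf evQ).
  have sRM : h |: Q \subset M by rewrite subUset sub1set Mh.
  exists (h |: Q).
    apply/dng_optionP; split=> //; first exact: ngM.
    by exists h; rewrite // inE Q'h (subsetP sMG).
  by rewrite sRM cardsU1 Q'h /= evQ defQ !inE Pm !orbT.
- apply/dng_optionP; split; try by apply: ngM; rewrite ?sub0set ?sub1set.
  by exists m; rewrite ?setU0 // setD0 (subsetP sMG).
by rewrite set11 sub1set Mm cards1.
Qed.

(** The second player makes the generated subgroup have even order at the first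
    reply; afterwards a position of odd cardinal never fills the subgroup that
    it generates, so the second player can stay inside that subgroup. *)
Lemma first_player_loses_DNG :
    (forall g, g \in G -> exists2 t, t \in G &
       2 %| #|<<[set t; g]>>| /\ <<[set t; g]>> <> G) ->
  ~ first_player_wins_DNG G.
Proof.
move=> evenG.
pose B P := [&& P \subset G, ~~ odd #|P| & (P == set0) || (2 %| #|<<P>>|)].
have opt_card P Q : dng_option G P Q -> #|P| < #|Q| <= #|gT|.
  by move/dng_option_gen/gen_option_card.
apply: (first_player_losesI (B := B) opt_card); last first.
  by rewrite /B sub0set cards0 eqxx.
move=> P Q /and3P[sPG evP evgP] /dng_optionP[_ nQG [g /setDP[Gg P'g] defQ]].
have sQG : Q \subset G by rewrite defQ subUset sub1set Gg.
have oddQ : odd #|Q| by rewrite defQ cardsU1 P'g.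
(* If <<Q>> has even order, any unselected element of it is a safe reply;
   otherwise [g] was the first move and [evenG] supplies the reply. *)
have [evQ | noevQ] := boolP (2 %| #|<<Q>>|).
  have [|h Qh Q'h] := parity_proper _ (subset_gen Q).
    by rewrite oddQ -[odd #|<<_>>|]negbK -dvdn2 evQ.
  have Gh : h \in G by apply: subsetP Qh; rewrite gen_subG.
  have eR : <<h |: Q>> = <<Q>>.
    apply/eqP; rewrite eqEsubset (genS (subsetUr _ _)) andbT.
    by rewrite gen_subG subUset sub1set Qh subset_gen.
  exists (h |: Q).
    by apply/dng_optionP; rewrite eR; split=> //; exists h; rewrite // inE Q'h.
  by rewrite /B eR evQ orbT subUset sub1set Gh sQG cardsU1 Q'h /= oddQ.
have P0 : P = set0.
  case/orP: evgP => [/eqP // | evgP]; case/negP: noevQ.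
  by apply: dvdn_trans evgP (cardSg (genS _)); rewrite defQ subsetUr.
rewrite P0 setU0 in defQ; subst P Q.
have [t Gt [evR nRG]] := evenG g Gg.
have gt : t \notin [set g].
  by apply: contra noevQ => /set1P tg; rewrite tg setUid in evR.
exists [set t; g]; last first.
  by rewrite /B evR orbT subUset sub1set Gt sQG cardsU1 gt cards1.
by apply/dng_optionP; split=> //; exists t; rewrite // inE gt.
Qed.

End GroupGames.

(** * The equivalence of points given by the transpositions of a group *)

Section LinkedPoints.

Local Open Scope group_scope.

Variables (T : finType) (G : {group {perm T}}).

Definition linked (u v : T) : bool := tperm u v \in G.

Lemma linked_refl u : linked u u.
Proof. by rewrite /linked tperm1 group1. Qed.

Lemma linked_sym u v : linked u v = linked v u.
Proof. by rewrite /linked tpermC. Qed.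

(** Conjugating a transposition by [g] moves both its points by [g]. *)
Lemma linked_perm g u v : g \in G -> linked u v -> linked (g u) (g v).
Proof. by move=> Gg Guv; rewrite /linked -tpermJ groupJ. Qed.

Lemma linked_trans u v w : linked u v -> linked v w -> linked u w.
Proof.
move=> Guv Gvw.
have [eq_vu|neq_vu] := eqVneq v u; first by rewrite -eq_vu.
have [<-|neq_uw] := eqVneq u w; first exact: linked_refl.
by have := linked_perm Gvw Guv; rewrite tpermL tpermD // eq_sym.
Qed.

(** If [u] is equivalent to [y u], then the class of [u] is stable under [y]. *)
Lemma linked_iter y u c k :
  y \in G -> linked u (y u) -> linked u c -> linked u ((y ^+ k) c).
Proof.
move=> Gy Guyu Guc; rewrite permX; elim: k => //= k IHk.
exact: linked_trans Guyu (linked_perm Gy IHk).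
Qed.

Lemma linked_full u : (forall v, linked u v) -> G :=: [set: {perm T}].
Proof.
move=> Gu; apply/eqP; rewrite eqEsubset subsetT /=.
apply/subsetP=> s _; have [ts -> _] := prod_tpermP s.
apply: group_prod => t _; apply: linked_trans (Gu _).
by rewrite linked_sym Gu.
Qed.

End LinkedPoints.

(** * Cycles on duplicate-free sequences *)

Section Cycles.

Local Open Scope group_scope.

Variable T : finType.

Definition seq_cycle (s : seq T) (Us : uniq s) : {perm T} :=
  perm (can_inj (prev_next Us)).

Lemma next_notin (s : seq T) x : x \notin s -> next s x = x.
Proof. by move=> s'x; rewrite next_nth (negPf s'x). Qed.

Lemma seq_cycle_trans s (Us : uniq s) c d :
  c \in s -> d \in s -> exists k, (seq_cycle Us ^+ k) c = d.
Proof.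
move=> sc sd; have := fconnect_cycle (cycle_next Us) sc d.
rewrite sd => /iter_findex <-; eexists; rewrite permX.
by apply: eq_iter => z; rewrite permE.
Qed.

Lemma seq_cycle_exp s (Us : uniq s) : seq_cycle Us ^+ size s = 1.
Proof.
apply/permP=> z; rewrite permX perm1 (eq_iter (permE _)).
have [sz|s'z] := boolP (z \in s); last first.
  by elim: (size s) => //= k ->; apply: next_notin.
rewrite -(order_cycle (cycle_next Us) Us sz) iter_order //.
exact: can_inj (prev_next Us).
Qed.

(** The product [y] of [tperm a b] and of the disjoint cycle on [s]. Since [s]
    has odd length, [y ^+ size s] is [tperm a b], so that every group containing
    [y] contains this transposition. *)
Lemma tperm_odd_cycle (a b : T) (s : seq T) :
    uniq [:: a, b & s] -> odd (size s) ->
  exists y : {perm T},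
    [/\ y a = b,
        {in s, forall c, y c = next s c},
        {in s &, forall c d, exists k, (y ^+ k) c = d},
        forall f, f \notin [:: a, b & s] -> y f = f &
        forall G : {group {perm T}}, y \in G -> tperm a b \in G].
Proof.
rewrite /= inE negb_or -andbA => /and4P[neq_ab s'a s'b Us] odd_s.
pose z := seq_cycle Us; pose y := tperm a b * z.
have zE c : z c = next s c by rewrite permE.
have yE c : c \in s -> y c = next s c.
  move=> sc; rewrite permM tpermD ?zE //.
    by apply: contraNneq s'a => ->.
  by apply: contraNneq s'b => ->.
have cyz : commute (tperm a b) z.
  rewrite /commute -[LHS](mulKVg z) -/(conjg _ z); congr (_ * _).
  by rewrite tpermJ !zE !next_notin.
exists y; split => //.
- by rewrite permM tpermL zE next_notin.
- move=> c d sc sd; have [k <-] := seq_cycle_trans Us sc sd; exists k.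
  rewrite !permX; elim: k => //= k ->; rewrite yE ?zE //.
  rewrite -permX; elim: k => [|k IHk]; first by rewrite perm1.
  by rewrite expgSr permM zE mem_next.
- move=> f; rewrite !inE !negb_or => /and3P[neq_fa neq_fb s'f].
  by rewrite permM tpermD 1?eq_sym // zE next_notin.
move=> G Gy; suffices <-: y ^+ size s = tperm a b by rewrite groupX.
rewrite expgMn // seq_cycle_exp mulg1 -[size s]odd_double_half odd_s.
by rewrite -mul2n expgD expgM expg1 expgS expg1 tperm2 expg1n mulg1.
Qed.

Lemma complement_seq (s : seq T) :
  uniq s -> exists s' : seq T,
    [/\ uniq (s ++ s'), s ++ s' =i T & #|T| = size s + size s'].
Proof.
move=> Us; exists [seq z <- enum T | z \notin s]; set s' := filter _ _.
have Us' : uniq (s ++ s').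
  rewrite cat_uniq Us filter_uniq ?enum_uniq // andbT.
  by apply/hasPn=> z; rewrite mem_filter => /andP[].
have Ts' : s ++ s' =i T.
  by move=> z; rewrite mem_cat mem_filter mem_enum inE andbT orbN.
by split=> //; rewrite -size_cat -(card_uniqP Us'); apply: eq_card => z.
Qed.

End Cycles.

(** * Generating pairs of a symmetric group *)

Section GeneratingPairs.

Local Open Scope group_scope.

Variable T : finType.
Implicit Types x y : {perm T}.

Definition has_mate x := exists y, <<[set x; y]>> = [set: {perm T}].

Lemma linked_mate x y (u : T) :
    (forall G : {group {perm T}}, x \in G -> y \in G -> forall v, linked G u v) ->
  has_mate x.
Proof.
move=> xyu; exists y; apply: (@linked_full _ _ u).
by apply: xyu; apply: mem_gen; rewrite !inE eqxx ?orbT.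
Qed.

(** The mate is a cycle through all points in which [v] follows [u]: the class
    of [u] contains its image [v], hence is stable under the cycle. *)
Lemma mate_tperm (u v : T) : u != v -> has_mate (tperm u v).
Proof.
move=> neq_uv; have Us : uniq [:: u; v] by rewrite /= inE neq_uv.
have [s [Us' Ts _]] := complement_seq Us.
have yu : seq_cycle Us' u = v by rewrite permE /= eqxx.
apply: (@linked_mate _ (seq_cycle Us') u) => G Gx Gy w.
have [||k <-] := @seq_cycle_trans _ _ Us' u w; rewrite ?Ts //.
by apply: linked_iter; rewrite ?yu // linked_refl.
Qed.

(** The mate is the product of [tperm a b] and of the cycle on [s]. It makes
    [a] and [b] equivalent, and a class absorbs the whole of [s] as soon as it
    meets [s] and is stable under the mate. Every [u] outside [s] has a stable class, since it is [a], [b] or a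
    fixed point. *)
Lemma paired_cycle_mate x a b s :
    uniq [:: a, b & s] -> odd (size s) ->
    (forall G : {group {perm T}}, x \in G -> linked G a b ->
       (forall u c d, c \in s -> d \in s ->
          u \notin s \/ linked G u (next s u) -> linked G u c -> linked G u d) ->
     forall v, linked G a v) ->
  has_mate x.
Proof.
move=> Us odd_s lin.
have [y [ya ys y_trans y_fix yab]] := tperm_odd_cycle Us odd_s.
apply: (@linked_mate _ y a) => G Gx Gy; have lab : linked G a b := yab G Gy.
apply: lin => // u c d sc sd su luc; have [k <-] := y_trans c d sc sd.
apply: linked_iter => //; have [s_u|s'u] := boolP (u \in s).
  by case: su; rewrite ?s_u // ys.
have [->|neq_ua] := eqVneq u a; first by rewrite ya.
have [->|neq_ub] := eqVneq u b.
  by apply: linked_trans (linked_perm Gy lab); rewrite ya linked_refl.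
by rewrite y_fix ?linked_refl // !inE !negb_or neq_ua neq_ub.
Qed.

Lemma perm_moved x : x != 1 -> exists a, x a != a.
Proof.
move=> ntx; apply/existsP; apply: contraR ntx => /existsPn x1.
by apply/eqP/permP=> z; rewrite perm1; apply/eqP/negPn.
Qed.

(** Let [c := x a], and let [b] be a third point. From the equivalence of [a] and
    [b] follows that of [c] and [x b]. If [x b] is [a] or [b], the class of [a]
    meets the cycle. Otherwise [c] and [x b] both lie on the cycle; they are
    placed next to each other, so that the whole cycle is one class. By parity
    the cycle has a third point [z], and [x^-1] maps [c] to [a] and [z] into the
    cycle again, which makes the cycle equivalent to [a]. *)
Lemma mate_odd x : odd #|T| -> x != 1 -> has_mate x.
Proof.
move=> oddT /perm_moved[a xa].
have [|[|b s0] [Uacb _ cardT]] := @complement_seq _ [:: a; x a].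
- by rewrite /= inE eq_sym xa.
- by rewrite cardT in oddT.
have /and3P[neq_ca neq_ba neq_bc] : [&& x a != a, b != a & b != x a].
  move: Uacb; rewrite /= !inE !negb_or -!andbA => /and5P[nac nab _ ncb _].
  by rewrite !(eq_sym _ a) (eq_sym b) nac nab.
set c := x a in neq_ca neq_bc *.
have neq_dc : x b != c by rewrite (inj_eq perm_inj).
have [/orP xb_ab|] := boolP ((x b == a) || (x b == b)).
  have [|s [Us Ts cardT']] := @complement_seq _ [:: a; b; c].
    by rewrite /= !inE !negb_or eq_sym neq_ba eq_sym neq_ca neq_bc.
  apply: (@paired_cycle_mate x a b (c :: s)) => // [|G Gx lab absorb].
    by rewrite cardT' /= negbK in oddT.
  have lac : linked G a c.
    have lcd : linked G c (x b) := linked_perm Gx lab.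
    rewrite linked_sym; case: xb_ab lcd => /eqP-> // lcb.
    by apply: linked_trans lcb _; rewrite linked_sym.
  move=> v; have:= Ts v; rewrite [v \in T]inE /= 2!in_cons.
  case/or3P=> [/eqP->|/eqP->|sv] //.
    exact: linked_refl.
  apply: absorb lac => //; first exact: mem_head.
  by left; case/andP: Us; rewrite in_cons negb_or => /andP[].
rewrite negb_or => /andP[neq_da neq_db].
have [|s [Us Ts cardT']] := @complement_seq _ [:: a; b; c; x b].
  rewrite /= !inE !negb_or !(eq_sym a) neq_ba neq_ca neq_da neq_bc.
  by rewrite !(eq_sym _ (x b)) neq_dc neq_db.
case: s => [|z s] in Us Ts cardT' *; first by rewrite cardT' in oddT.
apply: (@paired_cycle_mate x a b [:: c, x b, z & s]) => // [|G Gx lab absorb].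
  by rewrite cardT' /= !negbK in oddT *.
have lcd : linked G c (x b) := linked_perm Gx lab.
set S := [:: c, x b, z & s] in absorb *.
have cS v : v \in S -> linked G c v.
  move=> Sv; apply: absorb (lcd) => //; try by rewrite !inE eqxx ?orbT.
  by right; rewrite /S /= eqxx.
have [Sz z'c z'd] : [/\ z \in S, z != c & z != x b].
  split; first by rewrite !inE eqxx !orbT.
    by apply: contraTneq Us => ->; rewrite /= !inE eqxx /= ?orbT ?andbF.
  by apply: contraTneq Us => ->; rewrite /= !inE eqxx /= ?orbT ?andbF.
have TS v : [|| v == a, v == b | v \in S] by have:= Ts v; rewrite [v \in T]inE.
pose w := x^-1 z; have xw : x w = z by rewrite permKV.
have Sw : w \in S.
  case/or3P: (TS w) => // /eqP def_w; rewrite def_w in xw.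
    by rewrite -xw eqxx in z'c.
  by rewrite -xw eqxx in z'd.
have law : linked G a w.
  by have:= linked_perm (groupVr Gx) (cS z Sz); rewrite permK.
have lac : linked G a c by rewrite (linked_trans law) // linked_sym cS.
move=> v; case/or3P: (TS v) => [/eqP->|/eqP->|Sv] //; first exact: linked_refl.
exact: linked_trans lac (cS v Sv).
Qed.

(** The mate fixes [f := x p], transposes [p] and [b], and has [r := x f] on its
    cycle. From the equivalence of [p] and [b] follows that of [f] and [x b].
    Either [x b] is [p] or [b], so that [p] is equivalent to [f] and, applying
    [x], [f] to [r]; or [x b] lies on the cycle, so that [f] is equivalent to
    [r] and, applying [x^-1], [p] to [f]. *)
Lemma mate_long_cycle x p :
  ~~ odd #|T| -> x p != p -> x (x p) != p -> has_mate x.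
Proof.
move=> evenT xp xxp.
have xxp' : x (x p) != x p by rewrite (inj_eq perm_inj).
have Upfr : uniq [:: p; x p; x (x p)].
  by rewrite /= !inE !negb_or !(eq_sym p) xp xxp eq_sym xxp'.
have [[|b s0] [Us0 _ cardT0]] := complement_seq Upfr.
  by rewrite cardT0 in evenT.
have /and3P[bp bf br] : [&& b != p, b != x p & b != x (x p)].
  move: Us0; rewrite cat_uniq => /and3P[_ /hasPn/(_ b (mem_head _ _)) + _].
  by rewrite !inE !negb_or.
set f := x p in xp xxp xxp' bf br *; set r := x f in xxp xxp' br *.
have [|s [Us Ts cardT]] := @complement_seq _ [:: p; b; f; r].
  by rewrite /= !inE !negb_or !(eq_sym p) bp xp xxp bf br eq_sym xxp'.
apply: (@paired_cycle_mate x p b (r :: s)) => [||G Gx lpb absorb].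
- by apply: subseq_uniq Us; rewrite /= !eqxx (negPf xxp') /= eqxx subseq_refl.
- by rewrite cardT /= !negbK in evenT.
have TS v : [|| v == p, v == b, v == f | v \in r :: s].
  by have:= Ts v; rewrite [v \in T]inE.
have [p'S f'S] : p \notin r :: s /\ f \notin r :: s.
  move: Us; rewrite (@cat_uniq _ [:: p; b; f] (r :: s)) => /and3P[_ /hasPn Us _].
  by split; apply/negP=> /Us; rewrite !inE eqxx ?orbT.
have lfxb : linked G f (x b) := linked_perm Gx lpb.
have [lpf lpr] : linked G p f /\ linked G p r.
  case/or4P: (TS (x b)) => [/eqP xb|/eqP xb|/eqP xb|Sxb].
  - have lpf : linked G p f by rewrite linked_sym -xb.
    by split=> //; apply: linked_trans lpf (linked_perm Gx lpf).
  - have lpf : linked G p f by rewrite (linked_trans lpb) // -{1}xb linked_sym.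
    by split=> //; apply: linked_trans lpf (linked_perm Gx lpf).
  - by case/eqP: bp; apply: (@perm_inj _ x).
  have lfr : linked G f r by apply: absorb lfxb; rewrite ?mem_head //; left.
  have lpf : linked G p f.
    by have:= linked_perm (groupVr Gx) lfr; rewrite !permK.
  by split=> //; apply: linked_trans lpf lfr.
move=> v; case/or4P: (TS v) => [/eqP->|/eqP->|/eqP->|Sv] //.
  exact: linked_refl.
by apply: absorb lpr => //; [apply: mem_head | left].
Qed.

(** The mate fixes [f := x a], transposes [a] and [b], and has [c := x b] on its
    cycle. Applying [x] to the pair [a], [b] makes [f] equivalent to [c], hence
    to the whole cycle. With more than 4 points the cycle contains some [d]
    other than [c], and then [x d] lies on it too, because the points outside
    are the images of [f], [c] and [a]. Applying [x] to the pair [f], [d] makes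
    [a] equivalent to [x d]. *)
Lemma mate_two_swaps x a b :
    ~~ odd #|T| -> 4 < #|T| -> x (x a) = a -> x (x b) = b ->
    x a != a -> x b != b -> b != a -> b != x a ->
  has_mate x.
Proof.
move=> evenT T_gt4 xxa xxb xa xb ba bxa.
set f := x a in xxa xa bxa *; set c := x b in xxb xb *.
have cf : c != f by rewrite (inj_eq perm_inj).
have ca : c != a by rewrite -xxa (inj_eq perm_inj).
have [|[|d s] [Us Ts cardT]] := @complement_seq _ [:: a; b; f; c].
- by rewrite /= !inE !negb_or !(eq_sym a) ba xa ca bxa !(eq_sym _ c) xb cf.
- by rewrite cardT in T_gt4.
set S := [:: c, d & s].
apply: (@paired_cycle_mate x a b S) => [||G Gx lab absorb].
- by apply: subseq_uniq Us; rewrite /S /= !eqxx (negPf cf) /= eqxx /= ?eqxx subseq_refl.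
- by rewrite cardT /= !negbK in evenT *.
have TS v : [|| v == a, v == b, v == f | v \in S].
  by have:= Ts v; rewrite [v \in T]inE.
have [a'S f'S] : a \notin S /\ f \notin S.
  move: Us; rewrite (@cat_uniq _ [:: a; b; f] S) => /and3P[_ /hasPn U' _].
  by split; apply/negP=> /U'; rewrite !inE eqxx ?orbT.
have Sd : d \in S by rewrite !inE eqxx orbT.
have Sc : c \in S by apply: mem_head.
have lfc : linked G f c := linked_perm Gx lab.
have lfS v : v \in S -> linked G f v.
  by move=> Sv; apply: absorb (lfc) => //; left.
have Sxd : x d \in S.
  have: d \notin [:: a; b; f; c].
    move: Us; rewrite (@cat_uniq _ [:: a; b; f; c]) => /and3P[_ /hasPn U' _].
    exact/U'/mem_head.
  rewrite !inE !negb_or => /and4P[da db df dc].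
  have x_d := perm_inj (s := x).
  case/or4P: (TS (x d)) => // /eqP xd.
  - by case/eqP: df; apply: (x_d); rewrite xd.
  - by case/eqP: dc; apply: (x_d); rewrite xd.
  - by case/eqP: da; apply: (x_d); rewrite xd.
have laxd : linked G a (x d) by have:= linked_perm Gx (lfS d Sd); rewrite xxa.
have laf : linked G a f.
  by rewrite (linked_trans laxd) // linked_sym lfS.
move=> v; case/or4P: (TS v) => [/eqP->|/eqP->|/eqP->|Sv] //.
  exact: linked_refl.
exact: linked_trans laf (lfS v Sv).
Qed.

Lemma perm_trichotomy x : x != 1 ->
  [\/ exists2 p, x p != p & x (x p) != p,
      exists2 u, x u != u & x = tperm u (x u) |
      involutive x /\ exists a b, [/\ x a != a, x b != b, b != a & b != x a]].
Proof.
move=> /perm_moved[a xa].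
have [/existsP[p xxp]|/existsPn x2] := boolP [exists p, x (x p) != p].
  constructor 1; exists p => //.
  by apply: contraNneq xxp => xp; rewrite !xp.
have [/existsP[b /and3P[ba bxa xb]]|] :=
    boolP [exists b, [&& b != a, b != x a & x b != b]].
  constructor 3; split; last by exists a, b.
  by move=> p; apply/eqP/negPn/x2.
move/existsPn=> xfix; constructor 2; exists a => //.
apply/permP=> z; case: tpermP => [->//|->|/eqP za /eqP zxa].
  exact/eqP/negPn/x2.
by have:= xfix z; rewrite za zxa /= negbK => /eqP.
Qed.

Lemma mate_even x : ~~ odd #|T| -> 4 < #|T| -> x != 1 -> has_mate x.
Proof.
move=> evenT T_gt4 /perm_trichotomy.
case=> [[p xp xxp]|[u xu ->]|[x2 [a [b [xa xb ba bxa]]]]].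
- exact: (@mate_long_cycle x p).
- by apply: mate_tperm; rewrite eq_sym.
- by apply: (@mate_two_swaps x a b); rewrite ?x2.
Qed.

End GeneratingPairs.

(** * Parity and noncommutativity *)

Section PermFacts.

Local Open Scope group_scope.

Variable T : finType.

Lemma perm_noncyclic : 2 < #|T| -> ~~ cyclic [set: {perm T}].
Proof.
move=> T_gt2; have [s [Us _ sz]] := @complement_seq T [::] isT.
case: s => [|i [|j [|k s]]] in Us sz *; rewrite ?sz // in T_gt2.
have /and3P[ij ik jk] : [&& i != j, i != k & j != k].
  by move: Us; rewrite /= !inE !negb_or -!andbA => /and5P[-> -> _ ->].
apply/negP=> /cyclic_abelian/centsP abT.
have /permP/(_ i) := abT (tperm i j) (in_setT _) (tperm i k) (in_setT _).
rewrite !permM !tpermL (tpermD ik jk) tpermD // 1?eq_sym // => jk'.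
by rewrite jk' eqxx in jk.
Qed.

Lemma odd_perm_order (g : {perm T}) : odd_perm g -> ~~ odd #[g].
Proof.
move=> odd_g; have oddX k : odd_perm (g ^+ k) = odd k.
  by elim: k => [|k IHk]; rewrite ?odd_perm1 // expgS odd_permM odd_g IHk.
by rewrite -oddX expg_order odd_perm1.
Qed.

Lemma double_transposition : 3 < #|T| ->
  exists d : {perm T},
    [/\ #[d] = 2, odd_perm d = false & #|T| = 4 -> forall z, d z != z].
Proof.
move=> T_gt3; have [s [Us Ts sz]] := @complement_seq T [::] isT.
case: s => [|i [|j [|k [|l s]]]] in Us Ts sz *; rewrite ?sz // in T_gt3.
have /and5P[ij ik il jk /andP[jl kl]] :
    [&& i != j, i != k, i != l, j != k, j != l & k != l].
  move: Us; rewrite /= !inE !negb_or -!andbA.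
  by case/and5P=> -> -> -> _ /and5P[-> -> _ -> _].
pose d := tperm i j * tperm k l.
have [di dj dk dl] : [/\ d i = j, d j = i, d k = l & d l = k].
  rewrite /d !permM tpermL tpermR (@tpermD _ i j k) // (@tpermD _ i j l) //.
  by rewrite tpermL tpermR !tpermD // eq_sym.
exists d; split.
- apply: nt_prime_order => //.
    apply/permP=> z; rewrite expgS expg1 perm1 permM.
    have [zij | /norP[zi zj]] := boolP ((z == i) || (z == j)).
      by case/orP: zij => /eqP->; rewrite ?di ?dj ?di.
    have [zkl | /norP[zk zl]] := boolP ((z == k) || (z == l)).
      by case/orP: zkl => /eqP->; rewrite ?dk ?dl ?dk.
    have dz : d z = z by rewrite permM !tpermD // eq_sym.
    by rewrite !dz.
  by apply: contraNneq ij => d1; rewrite -di d1 perm1.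
- by rewrite odd_permM !odd_tperm ij kl.
move=> T4 z; move: (Ts z); case: s {Us Ts T_gt3} sz => [_|m s]; last by rewrite T4.
rewrite /= !inE => /or4P[]/eqP->; rewrite ?di ?dj ?dk ?dl //; by rewrite eq_sym.
Qed.

End PermFacts.

(** * The Klein group of a set of four points *)

Section PairPartitions.

Local Open Scope group_scope.

Variable T : finType.
Hypothesis cardT : #|T| = 4.

(** The Klein group, encoded as the kernel of the action of the permutations on
    the three partitions of the points into two pairs; this makes it visibly a
    normal subgroup. *)
Definition pair_partition_stab : {set {perm T}} :=
  [set x : {perm T} | [forall A : {set T},
     (#|A| == 2) ==> (x @: A == A) || (x @: A == ~: A)]].

Lemma pair_partition_stabP (x : {perm T}) :
  reflect (forall A : {set T}, #|A| = 2 -> x @: A = A \/ x @: A = ~: A)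
          (x \in pair_partition_stab).
Proof.
rewrite inE; apply: (iffP forallP) => V_x A => [A2|].
  by have:= V_x A; rewrite A2 => /orP[]/eqP; [left | right].
apply/implyP=> /eqP A2; apply/orP.
by have [] := V_x A A2 => ->; [left | right].
Qed.

Lemma imset_permC (x : {perm T}) (A : {set T}) : x @: (~: A) = ~: (x @: A).
Proof. by rewrite -!preim_permV; apply/setP=> z; rewrite !inE. Qed.

Fact pair_partition_stab_group_set : group_set pair_partition_stab.
Proof.
apply/group_setP; split=> [|x y /pair_partition_stabP Vx /pair_partition_stabP Vy].
  apply/pair_partition_stabP=> A _; left; apply/setP=> z.
  by rewrite -preim_permV invg1 inE perm1.
apply/pair_partition_stabP=> A A2.
have -> : (x * y) @: A = y @: (x @: A).
  by rewrite -imset_comp; apply: eq_imset => z; rewrite permM.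
by case: (Vx A A2) (Vy A A2) => -> [] yA; rewrite ?imset_permC yA ?setCK; auto.
Qed.
Canonical pair_partition_stab_group := Group pair_partition_stab_group_set.

Lemma pair_partition_stab_normal :
  pair_partition_stab_group <| [set: {perm T}].
Proof.
rewrite /normal subsetT; apply/subsetP=> g _; rewrite inE.
apply/subsetP=> _ /imsetP[x /pair_partition_stabP Vx ->].
apply/pair_partition_stabP=> A A2.
have -> : (x ^ g) @: A = g @: (x @: (g^-1 @: A)).
  by rewrite -!imset_comp; apply: eq_imset => z; rewrite /= conjgE !permM.
have gA : g @: (g^-1 @: A) = A.
  by rewrite -imset_comp -[RHS]imset_id; apply: eq_imset => z /=; rewrite permKV.
have [|->|->] := Vx (g^-1 @: A); first by rewrite card_imset //; apply: perm_inj.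
  by left.
by right; rewrite imset_permC gA.
Qed.

(** Such an [x] either exchanges the two points of a pair or sends both of them
    outside of the pair. *)
Lemma fixfree_involution_pair_partition (x : {perm T}) :
  involutive x -> (forall i, x i != i) -> x \in pair_partition_stab.
Proof.
move=> x2 xfix; apply/pair_partition_stabP=> A A2.
have xA2 : #|x @: A| = 2 by rewrite card_imset //; apply: perm_inj.
have cA2 : #|~: A| = 2 by apply/eqP; rewrite -(eqn_add2l #|A|) cardsC cardT A2.
have /cards2P[i [j [ij defA]]] : #|A| == 2 by rewrite A2.
have [xi|xi] := eqVneq (x i) j; [left|right];
  apply/eqP; rewrite eqEcard ?xA2 ?A2 ?cA2 leqnn andbT.
  rewrite defA imsetU1 imset_set1 xi -{2}xi x2.
  by rewrite setUC.
rewrite defA imsetU1 imset_set1; apply/subsetP=> z.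
rewrite !inE negb_or => /orP[]/eqP->; rewrite ?xfix ?xi // andbT.
by apply: contraNneq xi => <-; rewrite x2.
Qed.

(** An involution that moves at least two pairs of points has no fixed point
    among four, so it lies in the Klein group; every other nontrivial
    permutation has a mate already found above. *)
Lemma mate_four (x : {perm T}) : x \notin pair_partition_stab -> has_mate x.
Proof.
move=> V'x; have /perm_trichotomy : x != 1.
  by apply: contraNneq V'x => ->; apply: group1.
case=> [[p xp xxp]|[u xu ->]|[x2 [a [b [xa xb ba bxa]]]]].
- by apply: (@mate_long_cycle _ x p); rewrite ?cardT.
- by apply: mate_tperm; rewrite eq_sym.
case/negP: V'x; apply: fixfree_involution_pair_partition => // i.
have Uab : uniq [:: a; b; x a; x b].
  rewrite /= !inE !negb_or !(eq_sym a) ba xa bxa (eq_sym b) xb (inj_eq perm_inj).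
  by rewrite (eq_sym a) ba -(inj_eq (@perm_inj _ x)) x2 bxa.
have : i \in [:: a; b; x a; x b].
  by rewrite (subset_cardP _ (subset_predT _)) // (card_uniqP Uab) cardT.
rewrite !inE => /or4P[]/eqP-> //; by rewrite x2 eq_sym.
Qed.

(** If the quotient were cyclic, hence abelian, the Klein group would contain
    the commutator of two transpositions with a common point, a 3-cycle. *)
Lemma pair_partition_quotient_noncyclic :
  ~~ cyclic ([set: {perm T}] / pair_partition_stab_group).
Proof.
apply/negP=> /cyclic_abelian/(der1_min (normal_norm pair_partition_stab_normal)) sG'V.
have [s [Us Ts sz]] := @complement_seq T [::] isT.
case: s => [|i [|j [|k s]]] in Us Ts sz *; rewrite ?cardT // in sz.
pose t := [~ tperm i j, tperm i k] : {perm T}.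
have Vt : t \in pair_partition_stab_group.
  by apply: (subsetP sG'V); rewrite mem_commg ?inE.
have /and3P[ij ik jk] : [&& i != j, i != k & j != k].
  by move: Us; rewrite /= !inE !negb_or -!andbA => /and5P[-> -> _ ->].
have tE : t = tperm i j * tperm k j.
  by rewrite /t commgEl tpermV tpermJ tpermL tpermD // eq_sym.
have ti : t i = k by rewrite tE permM tpermL tpermR.
have tj : t j = i by rewrite tE permM tpermR tpermD // eq_sym.
have tij : t @: [set i; j] = [set i; k].
  by rewrite imsetU1 imset_set1 ti tj setUC.
case: (pair_partition_stabP _ Vt [set i; j]) => [|/setP|/setP].
    by rewrite cards2 ij.
  rewrite tij => /(_ k).
  by rewrite !inE eqxx orbT (eq_sym k i) (negPf ik) eq_sym (negPf jk).
by rewrite tij => /(_ i); rewrite !inE eqxx.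
Qed.

Lemma pair_partition_even : 2 %| #|pair_partition_stab_group|.
Proof.
have [|d [d2 _ dfix]] := @double_transposition T; first by rewrite cardT.
have dd : involutive d.
  move=> z; have /permP/(_ z) := expg_order d.
  by rewrite d2 expgS expg1 permM perm1.
rewrite -d2; apply: order_dvdG.
exact: (fixfree_involution_pair_partition dd (dfix cardT)).
Qed.

End PairPartitions.

(** * The games of the symmetric groups *)

Section SymmetricGroups.

Local Open Scope group_scope.

Variable n : nat.

Lemma first_player_wins_DNG_Sn_small :
  n \in [:: 2; 3]%N -> first_player_wins_DNG [set: 'S_n]%G.
Proof.
move=> n23.
have n_gt1 : 1 < #|'I_n| by move: n23; rewrite card_ord !inE => /orP[]/eqP->.
have [cA oA] : cyclic 'Alt_('I_n) /\ odd #|'Alt_('I_n)|.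
  have cA : #|'Alt_('I_n)| = n`!./2.
    by have := card_Alt n_gt1; rewrite card_ord => <-; rewrite mul2n doubleK.
  move: n23; rewrite !inE => /orP[]/eqP n_.
    have A1 : #|'Alt_('I_n)| = 1%N by rewrite cA n_.
    by rewrite A1 (card1_trivg A1) cyclic1.
  have A3 : #|'Alt_('I_n)| = 3 by rewrite cA n_.
  by rewrite A3 prime_cyclic ?A3.
by apply: (first_player_wins_DNG_index2 (subsetT _) (Alt_index n_gt1)).
Qed.

Lemma first_player_loses_DNG_Sn :
  3 < n -> ~ first_player_wins_DNG [set: 'S_n]%G.
Proof.
move=> n_gt3; have T_gt3 : 3 < #|'I_n| by rewrite card_ord.
apply: first_player_loses_DNG => g _.
have [odd_g | even_g] := boolP (odd_perm g).
  exists g; rewrite ?inE // setUid; split.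
    by rewrite dvdn2 odd_perm_order.
  move=> gT; have /negP[] := perm_noncyclic (ltnW T_gt3).
  by rewrite -[[set: _]]gT cycle_cyclic.
have [d [d2 even_d _]] := double_transposition T_gt3.
exists d; rewrite ?inE //; split.
  by rewrite -d2 order_dvdG // mem_gen // !inE eqxx.
move=> dgT; have : [set: 'S_n] \subset 'Alt_('I_n).
  rewrite -[[set: _]]dgT gen_subG; apply/subsetP=> z.
  by case/set2P=> ->; rewrite Alt_even ?even_d.
have [i [j ij]] : exists i j : 'I_n, i != j.
  exists (Ordinal (ltnW (ltnW (ltnW n_gt3)))), (Ordinal (ltnW (ltnW n_gt3))).
  by rewrite -val_eqE.
by move/subsetP/(_ (tperm i j) (in_setT _)); rewrite Alt_even odd_tperm ij.
Qed.

Lemma first_player_wins_GEN_Sn :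
  2 < n -> n != 4%N -> first_player_wins_GEN [set: 'S_n]%G.
Proof.
move=> n_gt2 n4; apply: first_player_wins_GEN_mates.
  by apply: perm_noncyclic; rewrite card_ord.
move=> x _ ntx; suffices [y defG] : has_mate x by exists y; rewrite ?inE.
have [odd_n | even_n] := boolP (odd n).
  by apply: mate_odd; rewrite ?card_ord.
apply: mate_even; rewrite ?card_ord // ltn_neqAle eq_sym n4.
by rewrite ltn_neqAle n_gt2 andbT; apply: contraNneq even_n => <-.
Qed.

End SymmetricGroups.

Lemma first_player_loses_GEN_S4 : ~ first_player_wins_GEN [set: 'S_4]%G.
Proof.
have T4 : #|'I_4| = 4 by rewrite card_ord.
apply: (first_player_loses_GEN_normal (pair_partition_stab_normal _)).
- exact: pair_partition_even T4.
- exact: pair_partition_quotient_noncyclic T4.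
move=> x /setDP[_ V'x]; have [y defG] := mate_four T4 V'x.
by exists y; rewrite ?inE.
Qed.

Theorem corollary4p4 :
  (forall n : nat, 2 <= n ->
     (first_player_wins_DNG [set: 'S_n]%G <-> n \in [:: 2; 3])) /\
  (forall n : nat, 1 <= n ->
     (first_player_wins_GEN [set: 'S_n]%G <-> n \notin [:: 1; 4])).
Proof.
split=> n n_pos; split.
- move=> win; have [n_gt3|] := ltnP 3 n.
    by case: (first_player_loses_DNG_Sn n_gt3).
  by case: n n_pos {win} => [|[|[|[|n]]]].
- exact: first_player_wins_DNG_Sn_small.
- move=> win; rewrite !inE; apply/norP; split; apply/eqP=> eq_n; subst n.
    apply: first_player_loses_GEN_trivial win.
    by apply: card1_trivg; rewrite cardsT card_Sn.
  exact: first_player_loses_GEN_S4 win.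
rewrite !inE negb_or => /andP[n1 n4].
have [n_gt2 | n_le2] := ltnP 2 n; first exact: first_player_wins_GEN_Sn.
have -> : n = 2 by case: n n_pos n1 n_le2 {n4} => [|[|[|n]]].
have card_S2 : #|[set: 'S_2]| = 2 by rewrite cardsT card_Sn.
apply: first_player_wins_GEN_cyclic; first by apply: prime_cyclic; rewrite card_S2.
by rewrite -cardG_gt1 card_S2.
Qed.
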